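(* Let $m>1$ be an integer that is not a perfect square and let $\ell\ge 5$ be an integer. Define $q=2\ell-4$ if $\ell\equiv 1$ or $3\pmod 4$, $q=\ell-2$ if $\ell\equiv 2\pmod 4$, and $q=\ell/2-1$ if $\ell\equiv 0\pmod 4$. Suppose there exist integers $x>0$, $y>0$ with $x^2-my^2=1$ such that either $$x+my\equiv -1 \pmod q \quad\text{and}\quad x+y\equiv -1\pmod q,$$ or $$my-x\equiv -1 \pmod q \quad\text{and}\quad x-y\equiv -1\pmod q.$$ Then there exist positive integers $r,s$ with $P(\ell,r)=m\,P(\ell,s)$. Moreover, in that case there are infinitely many such pairs $(r,s)$.
   Context: For integers $\ell\ge 3$ and $r\ge 1$, the $r$-th $\ell$-gonal number is $P(\ell,r)=\frac{(\ell-2)r^2-(\ell-4)r}{2}$. *)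

(* Defs.v *)
From mathcomp Require Import all_boot all_order all_algebra.
From mathcomp Require Import ring zify.

Set Implicit Arguments.
Unset Strict Implicit.
Unset Printing Implicit Defensive.

Import Order.TTheory GRing.Theory Num.Theory.
Local Open Scope ring_scope.

(* The Euclidean quotient by 2 is exact: see polygonalK. *)
Definition polygonal (l r : int) : int :=
  (((l - 2) * r ^+ 2 - (l - 4) * r) %/ 2)%Z.

Lemma polygonalK (l r : int) :
  polygonal l r * 2 = (l - 2) * r ^+ 2 - (l - 4) * r.
Proof.
apply: divzK.
have -> : (l - 2) * r ^+ 2 - (l - 4) * r = l * (r * (r - 1)) + (2 - r) * r * 2.
  by ring.
apply: rpredD; last exact: dvdz_mull.
apply: dvdz_mull.
have [k [->|->]] : exists k : int, r = k * 2 \/ r = k * 2 + 1.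
  by exists (r %/ 2)%Z; lia.
- by apply: dvdz_mulr; apply: dvdz_mull.
- by rewrite addrK; apply: dvdz_mull; apply: dvdz_mull.
Qed.

(* The last branch is reached only when 4 divides l, so l/2 is exact there. *)
Definition modulus (l : int) : int :=
  if ((l %% 4)%Z == 1) || ((l %% 4)%Z == 3) then 2 * l - 4
  else if (l %% 4)%Z == 2 then l - 2
  else (l %/ 2)%Z - 1.

(* Main.v *)
(* Completing the square, with X = 2(l-2)r - (l-4) and Y = 2(l-2)s - (l-4), the
   equation P(l,r) = m P(l,s) becomes X^2 - m Y^2 = (1-m)(l-4)^2.  This norm
   equation is solved by (l-4)(x + y sqrt m)(sqrt m + 1) and by
   (l-4)(x + y sqrt m)(sqrt m - 1), and q = 2(l-2) / gcd(2(l-2), l-4), so the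
   congruences modulo q say exactly that r and s are integers.  Multiplication
   by x + y sqrt m permutes the finite set of residues modulo 2(l-2), so some
   power of it sends each solution to a larger one in the same residue class. *)
Require Import Defs.
From mathcomp Require Import all_boot all_order all_algebra.
From mathcomp Require Import ring zify.
From mathcomp Require Import classical_sets cardinality.

Set Implicit Arguments.
Unset Strict Implicit.
Unset Printing Implicit Defensive.

Import Order.TTheory GRing.Theory Num.Theory.
Local Open Scope classical_set_scope.
Local Open Scope ring_scope.

(** Multiplication by [x + y sqrt m] in coordinates, over any ring so that it serves both [int] and
    ['Z_N]. *)
Definition pell_step (R : pzRingType) (m x y : R) (p : R * R) : R * R :=
  (x * p.1 + m * y * p.2, y * p.1 + x * p.2).

(** Norm 1 makes the conjugate [x - y sqrt m] an inverse. *)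
Lemma pell_step_inj (R : comPzRingType) (m x y : R) :
  x ^+ 2 - m * y ^+ 2 = 1 -> injective (pell_step m x y).
Proof.
move=> pell; apply: (can_inj (g := pell_step m x (- y))) => -[a b].
rewrite /pell_step /=; congr pair.
  by rewrite -[RHS]mul1r -pell; ring.
by rewrite -[RHS]mul1r -pell; ring.
Qed.

Lemma iter_pell_step_norm (R : comPzRingType) (m x y : R) (k : nat) (p : R * R) :
  x ^+ 2 - m * y ^+ 2 = 1 ->
  (iter k (pell_step m x y) p).1 ^+ 2 - m * (iter k (pell_step m x y) p).2 ^+ 2
  = p.1 ^+ 2 - m * p.2 ^+ 2.
Proof.
move=> pell; elim: k => [//|k <-] /=; set a := iter _ _ _.
by rewrite -[RHS]mul1r -pell; ring.
Qed.

Lemma iter_pell_step_morph (R S : pzRingType) (f : {rmorphism R -> S})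
    (m x y : R) (k : nat) (p : R * R) :
  iter k (pell_step (f m) (f x) (f y)) (f p.1, f p.2) =
  (f (iter k (pell_step m x y) p).1, f (iter k (pell_step m x y) p).2).
Proof. by elim: k => [//|k /= ->]; rewrite /pell_step /= !rmorphD !rmorphM. Qed.

(** Since [x >= 1], the diagonal terms do not shrink, and the cross terms are positive. *)
Lemma iter_pell_step_gt (m x y : int) (k : nat) (p : int * int) :
  0 < m -> 0 < x -> 0 < y -> 0 < p.1 -> 0 < p.2 ->
  p.1 < (iter k.+1 (pell_step m x y) p).1 /\
  p.2 < (iter k.+1 (pell_step m x y) p).2.
Proof.
move=> m0 x0 y0.
have step (a : int * int) : 0 < a.1 -> 0 < a.2 ->
    a.1 < (pell_step m x y a).1 /\ a.2 < (pell_step m x y a).2.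
  case: a => a b; rewrite /pell_step /= => a0 b0.
  have : 0 < m * y * b by rewrite !mulr_gt0.
  have : 0 < y * a by rewrite mulr_gt0.
  have : a <= x * a by rewrite ler_peMl // ltW.
  have : b <= x * b by rewrite ler_peMl // ltW.
  lia.
move=> p1 p2; elim: k => [|k IH]; first exact: step.
case: IH => u v; have [su sv] := step _ (lt_trans p1 u) (lt_trans p2 v).
by split; [apply: lt_trans su | apply: lt_trans sv].
Qed.

(** The bound on [N] matters: ['Z_0] and ['Z_1] default to a ring with two elements. *)
Lemma intr_Zp_inj_mod (N : nat) (a b : int) :
  (1 < N)%N -> a%:~R = b%:~R :> 'Z_N -> (N %| a - b)%Z.
Proof.
move=> N1 /eqP; rewrite -subr_eq0 -intrB => /eqP.
case: (a - b) => n /eqP.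
- rewrite -pmulrn => /eqP /(congr1 val) /=.
  by rewrite val_Zp_nat // dvdzE /= /dvdn => ->.
- rewrite NegzE mulrNz oppr_eq0 -pmulrn => /eqP /(congr1 val) /=.
  by rewrite val_Zp_nat // dvdzE /= /dvdn => ->.
Qed.

(** An injective self-map of the finite set of pairs over ['Z_N] is a permutation, so every orbit
    returns to its start. *)
Lemma iter_pell_step_periodic (N : nat) (m x y : int) (p : int * int) :
  (1 < N)%N -> x ^+ 2 - m * y ^+ 2 = 1 ->
  exists k : nat, (N %| (iter k.+1 (pell_step m x y) p).1 - p.1)%Z /\
                  (N %| (iter k.+1 (pell_step m x y) p).2 - p.2)%Z.
Proof.
move=> N1 pell; pose f : {rmorphism int -> 'Z_N} := intr.
have pellN : f x ^+ 2 - f m * f y ^+ 2 = 1.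
  by rewrite -!rmorphXn -rmorphM -rmorphB pell rmorph1.
have := iter_order (pell_step_inj pellN) (f p.1, f p.2).
(* The period is positive, which gives at least one step and hence strict growth later. *)
case E : (fingraph.order _ _) => [|k].
  by have := fingraph.order_gt0 (pell_step (f m) (f x) (f y)) (f p.1, f p.2);
     rewrite E.
rewrite iter_pell_step_morph => -[e1 e2].
by exists k; split; apply: intr_Zp_inj_mod.
Qed.

Lemma polygonal_pell (m l r s : int) : 2 < l ->
  (polygonal l r = m * polygonal l s) <->
  ((2 * (l - 2) * r - (l - 4)) ^+ 2 - m * (2 * (l - 2) * s - (l - 4)) ^+ 2 =
   (1 - m) * (l - 4) ^+ 2).
Proof.
move=> l2; have l0 : 8 * (l - 2) != 0 by lia.
(* Both sides rest on [X ^+ 2 = 8 * (l - 2) * P + (l - 4) ^+ 2]; the nonzero factor [8 * (l - 2)] is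
   cancelled below. *)
have -> : (2 * (l - 2) * r - (l - 4)) ^+ 2
    - m * (2 * (l - 2) * s - (l - 4)) ^+ 2
  = 4 * (l - 2) * (polygonal l r * 2 - m * (polygonal l s * 2))
    + (1 - m) * (l - 4) ^+ 2 by rewrite !polygonalK; ring.
split=> [->|]; first by ring.
move=> e; apply: (mulfI l0); apply/eqP; rewrite -subr_eq0; apply/eqP.
by rewrite -[RHS](subrr ((1 - m) * (l - 4) ^+ 2)) -[X in _ = X - _]e; ring.
Qed.

(** It suffices that [2 * (l - 2)] divides [(l - 4) * modulus l]. The quotient is [l - 4] over 1, 2
    or 4, the gcd of [2 * (l - 2)] and [l - 4] in the three cases. *)
Lemma dvdz_modulus (l a : int) : 5 <= l ->
  (a = -1 %[mod modulus l])%Z -> (2 * (l - 2) %| (l - 4) * (a + 1))%Z.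
Proof.
move=> l5 /eqP; rewrite eqz_mod_dvd opprK => /dvdzP [k ->].
rewrite mulrCA; apply: dvdz_mull; rewrite /modulus.
case: ifP => [_|]; first by apply: dvdz_mull; apply/dvdzP; exists 1; ring.
case: ifP => [l2 _|l2 l1].
- apply/dvdzP; exists ((l - 4) %/ 2)%Z.
  have [j ->] : exists j, l = 2 * j by exists (l %/ 2)%Z; lia.
  have -> : 2 * j - 4 = (j - 2) * 2 by ring.
  by rewrite mulzK //; ring.
- apply/dvdzP; exists ((l %/ 4)%Z - 1).
  have [j ->] : exists j, l = 4 * j by exists (l %/ 4)%Z; lia.
  have -> : ((4 * j) %/ 2)%Z = 2 * j by lia.
  have -> : ((4 * j) %/ 4)%Z = j by lia.
  by ring.
Qed.

Lemma polygonal_exists (m l a b : int) : 5 <= l -> 0 < a -> 0 < b ->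
  a ^+ 2 - m * b ^+ 2 = 1 - m ->
  (a = -1 %[mod modulus l])%Z -> (b = -1 %[mod modulus l])%Z ->
  exists r s : int, [/\ 0 < r, 0 < s & polygonal l r = m * polygonal l s].
Proof.
move=> l5 a0 b0 ab /(dvdz_modulus l5)/dvdzP [r er] /(dvdz_modulus l5)/dvdzP [s es].
have d0 : 0 < 2 * (l - 2) by lia.
have pos c t : 0 < c -> (l - 4) * (c + 1) = t * (2 * (l - 2)) -> 0 < t.
  by move=> c0 e; rewrite -(pmulr_lgt0 _ d0) -e mulr_gt0 //; lia.
(* These [r] and [s] solve [X = (l - 4) * a] and [Y = (l - 4) * b]. *)
exists r, s; split; [exact: pos er|exact: pos es|].
apply/polygonal_pell; first by lia.
rewrite !(mulrC (2 * (l - 2))) -er -es -ab; ring.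
Qed.

Lemma polygonal_next (m l x y r s : int) : 0 < m -> 3 <= l ->
  0 < x -> 0 < y -> x ^+ 2 - m * y ^+ 2 = 1 ->
  0 < r -> 0 < s -> polygonal l r = m * polygonal l s ->
  exists r' s' : int,
    [/\ r < r', s < s' & polygonal l r' = m * polygonal l s'].
Proof.
move=> m0 l3 x0 y0 pell r0 s0 rs.
have [d0 l2] : 0 < 2 * (l - 2) /\ 2 < l by lia.
have norm := (polygonal_pell m r s l2).1 rs.
pose N := absz (2 * (l - 2))%R.
have [N1 Nl] : (1 < N)%N /\ N%:Z = 2 * (l - 2) by rewrite /N; split; lia.
pose c t := 2 * (l - 2) * t - (l - 4).
(* At [t = 1] the value of [c] is [l]. *)
have cpos t : 0 < t -> 0 < c t.
  rewrite gtz0_ge1 => t1; have : 2 * (l - 2) <= 2 * (l - 2) * t.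
    by rewrite ler_peMr //; lia.
  by rewrite /c; lia.
have [k] := iter_pell_step_periodic (c r, c s) N1 pell.
have := iter_pell_step_gt k m0 x0 y0 (cpos _ r0 : 0 < (c r, c s).1) (cpos _ s0).
have := iter_pell_step_norm k.+1 (c r, c s) pell.
case: (iter k.+1 _ _) => a b /= nab [ra sb].
rewrite Nl => -[/dvdzP [u eu] /dvdzP [v ev]].
(* Staying in the residue class modulo [2 * (l - 2)] means being a value of [c] again. *)
have ea : a = c (r + u) by rewrite -[a](subrK (c r)) eu /c; ring.
have eb : b = c (s + v) by rewrite -[b](subrK (c s)) ev /c; ring.
exists (r + u), (s + v); split.
- by rewrite ltrDl -(pmulr_lgt0 _ d0) -eu subr_gt0.
- by rewrite ltrDl -(pmulr_lgt0 _ d0) -ev subr_gt0.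
- by apply/(polygonal_pell _ _ _ l2); rewrite -/(c _) -/(c (s + v)) -ea -eb nab.
Qed.

(** This gives positivity of [x - y] and [m * y - x] for the second pair of congruences. Squares are
    compared. *)
Lemma pell_bounds (m x y : int) : 1 < m -> 0 < x -> 0 < y ->
  x ^+ 2 - m * y ^+ 2 = 1 -> y < x /\ x < m * y.
Proof.
move=> m1 x0 y0 pell; have m0 : 0 < m := lt_trans ltr01 m1.
have sq_lt (a b : int) : 0 < a -> 0 < b -> a ^+ 2 < b ^+ 2 -> a < b.
  by move=> a0 b0; rewrite ltr_pXn2r // nnegrE ltW.
have xE : x ^+ 2 = m * y ^+ 2 + 1 by rewrite -pell; ring.
have y2 : 0 < y ^+ 2 by rewrite exprn_gt0.
split; apply: sq_lt; rewrite ?mulr_gt0 // ?exprMn xE.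
- by rewrite ltzD1 ler_peMl // ltW.
(* With [z = m * y ^+ 2 > 1], one has [z + 1 < 2 * z <= m * z]. *)
- have : 2 * (m * y ^+ 2) <= m * (m * y ^+ 2).
    by rewrite ler_wpM2r // ltW // mulr_gt0.
  have : m < m * y ^+ 2 + 1 by rewrite ltzD1 ler_peMr // ltW.
  by rewrite [m ^+ 2]expr2 -mulrA; move: (m * y ^+ 2) => z; clear -m1; lia.
Qed.

(** On a finite set [f] would be bounded, but each passage to a successor raises it by at least
    1. *)
Lemma infinite_set_no_max (T : choiceType) (f : T -> int) (S : set T) :
  S !=set0 -> (forall p, S p -> exists2 q, S q & f p < f q) -> infinite_set S.
Proof.
move=> [p0 Sp0] next /finite_seqP [s Ss].
have [B sB] : exists B : nat, forall p, p \in s -> f p <= B%:Z.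
  elim: s {Ss} => [|a s [B IH]]; first by exists 0%N.
  exists (maxn `|f a| B)%N => p; rewrite inE => /orP[/eqP ->|/IH]; lia.
have big n : exists2 p, S p & f p0 + n%:Z <= f p.
  elim: n => [|n [p Sp np]]; first by exists p0; rewrite // addr0.
  by have [q Sq pq] := next p Sp; exists q => //; lia.
have [p Sp] := big (B + `|f p0|).+1.
by have := sB p; rewrite Ss /= in Sp; move=> /(_ Sp); lia.
Qed.

Theorem theorem4 (m l : int) (m_gt1 : 1 < m)
    (m_nonsquare : ~ exists k : int, m = k ^+ 2) (l_ge5 : 5 <= l)
    (hxy : exists x y : int,
      [/\ 0 < x, 0 < y, x ^+ 2 - m * y ^+ 2 = 1 &
        ((x + m * y = -1 %[mod modulus l])%Z /\
         (x + y = -1 %[mod modulus l])%Z) \/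
        ((m * y - x = -1 %[mod modulus l])%Z /\
         (x - y = -1 %[mod modulus l])%Z)]) :
  (exists r s : int,
     [/\ 0 < r, 0 < s & polygonal l r = m * polygonal l s]) /\
  infinite_set [set p : int * int |
     [/\ 0 < p.1, 0 < p.2 & polygonal l p.1 = m * polygonal l p.2]].
Proof.
have [x [y [x0 y0 pell cong]]] := hxy.
have m0 : 0 < m := lt_trans ltr01 m_gt1.
have [y_x x_my] := pell_bounds m_gt1 x0 y0 pell.
have sol : exists r s : int,
    [/\ 0 < r, 0 < s & polygonal l r = m * polygonal l s].
  (* The alternatives are the products of [x + y sqrt m] with [sqrt m + 1] and [sqrt m - 1], both of
     norm [1 - m]. *)
  case: cong => -[ca cb]; apply: polygonal_exists ca cb => //.
  - by rewrite addr_gt0 // mulr_gt0.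
  - by rewrite addr_gt0.
  - by rewrite -[RHS]mulr1 -[X in _ = _ * X]pell; ring.
  - by rewrite subr_gt0.
  - by rewrite subr_gt0.
  - by rewrite -[RHS]mulr1 -[X in _ = _ * X]pell; ring.
split=> //; apply: (infinite_set_no_max (f := fst)).
  by have [r [s rs]] := sol; exists (r, s).
move=> [r s] /= [r0 s0 rs].
have l3 : 3 <= l := le_trans (isT : 3 <= 5 :> int) l_ge5.
have [r' [s' [rr' ss' rs']]] := polygonal_next m0 l3 x0 y0 pell r0 s0 rs.
by exists (r', s') => //; split=> //=; [apply: lt_trans rr' | apply: lt_trans ss'].
Qed.
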